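(* Let $I$ be a proper ideal of a numerical semigroup $S$, let $\mu(I)=\min(I)$, and let $p(X_1,\dots,X_n)=\sum_{i=1}^n a_iX_i+a_0$ be a linear endopattern of $I$. Then $p$ is a linear pattern admitted by $I$ and satisfies (i) $\sum_{i=1}^{n'}a_i\geq 0$ for all $1\leq n'<n$; (ii) $\sum_{i=1}^n a_i\geq \max(0,-a_0/\mu(I))$; (iii) $a_0>0$ or $\sum_{i=1}^{n}a_i>\max(0,-a_0/\mu(I))$ (or both).
   Context: $\mathbb{Z}_+$ denotes the set of non-negative integers. A numerical semigroup is a subset of $\mathbb{Z}_+$ that contains $0$, is closed under addition and has finite complement in $\mathbb{Z}_+$. An ideal of a numerical semigroup $S$ is a nonempty subset $I\subseteq S$ with $I+S\subseteq I$; it is proper if $I\ne S$. Linear patterns are polynomials $\sum_{i=1}^n a_iX_i+a_0$ with integer coefficients. A pattern $p$ is admitted by an ideal $I$ of $S$ if $p(s_1,\dots,s_n)\in S$ for every non-increasing sequence $s_1\ge\cdots\ge s_n$ of elements of $I$; a linear pattern is an endopattern of $I$ if all these values lie in $I$. *)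

(* Defs.v *)
From mathcomp Require Import all_boot all_order all_algebra.
From mathcomp Require Import mpoly.
From mathcomp Require Import boolp classical_sets functions cardinality.

Set Implicit Arguments.
Unset Strict Implicit.
Unset Printing Implicit Defensive.
Import Order.TTheory GRing.Theory Num.Theory.
Local Open Scope classical_set_scope.
Local Open Scope ring_scope.

Definition numerical_semigroup (S : set nat) : Prop :=
  [/\ S 0%N, forall x y, S x -> S y -> S (x + y)%N & finite_set (~` S)].

Definition semigroup_ideal (S I : set nat) : Prop :=
  [/\ I !=set0, I `<=` S & forall x y, I x -> S y -> I (x + y)%N].

Definition proper_semigroup_ideal (S I : set nat) : Prop :=
  semigroup_ideal S I /\ I <> S.

(* The default value 0 is only used when A is empty; see mu_min. *)
Definition mu (A : set nat) : nat :=
  xget 0%N [set m | A m /\ forall x, A x -> (m <= x)%N].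

Lemma mu_min (A : set nat) :
  A !=set0 -> A (mu A) /\ forall x, A x -> (mu A <= x)%N.
Proof.
move=> [x Ax]; rewrite /mu; case: xgetP => [m _ //|noMin]; exfalso.
have exA : exists x, `[< A x >] by exists x; apply/asboolP.
case: (ex_minnP exA) => m /asboolP Am minm.
by apply: (noMin m); split=> // y Ay; apply: minm; apply/asboolP.
Qed.

Section Patterns.
Variable n : nat.

(* Variables are indexed from 0: X_i of the mathematics is 'X_(i-1). *)
Definition linear_poly (a : 'I_n -> int) (a0 : int) : {mpoly int[n]} :=
  \sum_(i < n) a i *: 'X_i + a0%:MP.

Definition linear_pattern (p : {mpoly int[n]}) : Prop :=
  exists a a0, p = linear_poly a a0.

Definition nonincreasing_in (I : set nat) (s : 'I_n -> nat) : Prop :=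
  (forall i, I (s i)) /\ forall i j : 'I_n, (i <= j)%N -> (s j <= s i)%N.

(* Values of p are a priori arbitrary integers, so subsets of nat are
   compared with them through their image in int. *)
Definition takes_values_in (I T : set nat) (p : {mpoly int[n]}) : Prop :=
  forall s : 'I_n -> nat, nonincreasing_in I s ->
    (Posz @` T) p.@[fun i => (s i)%:Z].

Definition admitted (S I : set nat) (p : {mpoly int[n]}) : Prop :=
  takes_values_in I S p.

Definition linear_endopattern (I : set nat) (p : {mpoly int[n]}) : Prop :=
  linear_pattern p /\ takes_values_in I I p.

End Patterns.

(* Main.v *)
Require Import Defs.
From mathcomp Require Import all_boot all_order all_algebra.
From mathcomp Require Import mpoly.
From mathcomp Require Import boolp classical_sets functions cardinality.
From mathcomp Require Import lra.

Import Order.TTheory GRing.Theory Num.Theory.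
Local Open Scope classical_set_scope.
Local Open Scope ring_scope.

(** Write [m] for [mu I]; it is positive, because an ideal containing 0 is the
    whole semigroup. All the multiples [k.+1 * m] lie in [I], so [p] can be
    evaluated at the step sequences whose first [n'] entries are [k.+1 * m] and
    whose other entries are [m]. The value is
    [k * m * (a_1 + ... + a_n') + ((a_1 + ... + a_n) * m + a_0)], and since it
    belongs to [I] it is at least [m] (lemma [endopattern_step_ge]).

    The value being bounded below as [k] grows, every partial sum of the
    coefficients is nonnegative, including the full one. Taking [k = 0] gives
    [(a_1 + ... + a_n) * m + a_0 >= m > 0], hence the strict inequality
    [a_1 + ... + a_n > - a_0 / m]; if moreover [a_0 <= 0], the same bound makes
    the full sum positive, so that it strictly exceeds both terms of the
    maximum. Admissibility is the inclusion of [I] in [S]. *)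

Lemma proper_ideal_mu_gt0 (S I : set nat) :
  proper_semigroup_ideal S I -> (0 < mu I)%N.
Proof.
move=> [[I0 sIS IS] IneS]; rewrite lt0n; apply/eqP => mu0.
apply: IneS; apply/seteqP; split=> // x Sx.
by have [Imu _] := mu_min I0; rewrite mu0 in Imu; rewrite -[x]add0n; apply: IS.
Qed.

Lemma ideal_multiple (S I : set nat) (x k : nat) :
  semigroup_ideal S I -> I x -> I (k.+1 * x)%N.
Proof.
move=> [_ sIS IS] Ix; elim: k => [|k IHk]; first by rewrite mul1n.
by rewrite mulSn; apply: IS => //; apply: sIS.
Qed.

Lemma meval_linear_poly (n : nat) (a : 'I_n -> int) (a0 : int)
    (v : 'I_n -> int) :
  (linear_poly a a0).@[v] = \sum_(i < n) a i * v i + a0.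
Proof.
rewrite /linear_poly mevalD mevalC; congr (_ + _).
by rewrite raddf_sum; apply: eq_bigr => i _ /=; rewrite mevalZ mevalXU.
Qed.

(** The cut [n'] is allowed to be [n]: the step sequence is then constant, and
    the bound concerns the sum of all the coefficients. *)
Lemma endopattern_step_ge (S I : set nat) (n : nat) (a : 'I_n -> int)
    (a0 : int) (n' k : nat) :
  semigroup_ideal S I -> takes_values_in I I (linear_poly a a0) ->
  (mu I)%:Z <= (k * mu I)%:Z * (\sum_(i < n | (i < n')%N) a i)
               + ((\sum_(i < n) a i) * (mu I)%:Z + a0).
Proof.
move=> idI valI; have [I0 _ _] := idI; have [Imu mu_le] := mu_min I0.
pose s (i : 'I_n) := ((if (i < n')%N then k.+1 else 1) * mu I)%N.
have s_nonincr : nonincreasing_in I s.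
  split=> [i|i j le_ij]; rewrite /s.
    by case: ifP => _; apply: (ideal_multiple _ _ _ _ idI Imu).
  rewrite leq_mul2r; apply/orP; right.
  case: ifP => // lt_jn'; last by case: ifP.
  by rewrite (leq_ltn_trans le_ij lt_jn').
have [y Iy] := valI s s_nonincr; rewrite meval_linear_poly.
suff -> : \sum_(i < n) a i * (s i)%:Z =
          (k * mu I)%:Z * (\sum_(i < n | (i < n')%N) a i)
          + (\sum_(i < n) a i) * (mu I)%:Z.
  by rewrite -addrA => <-; rewrite lez_nat; apply: mu_le.
rewrite mulr_sumr mulr_suml [X in _ = X + _]big_mkcond -big_split.
apply: eq_bigr => i _ /=.
rewrite /s; case: ifP => _; last by rewrite mul1n add0r.
by rewrite mulSn PoszD mulrDr addrC (mulrC (a i) (k * mu I)%:Z).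
Qed.

Lemma coef_ge0_of_bounded_below (m : nat) (b c : int) :
  (0 < m)%N -> (forall k : nat, 0 <= (k * m)%:Z * b + c) -> 0 <= b.
Proof.
move=> m_gt0 bound; case: (lerP 0 b) => // b_lt0.
(* If b <= -1, the bound fails as soon as k exceeds c. *)
have := bound `|c|.+1; set t := (_ * m)%N => tb_ge0.
have t_gt : c < t%:Z.
  apply: le_lt_trans (ler_norm c) _.
  by rewrite -abszE ltz_nat /t leq_pmulr.
have : t%:Z * b <= t%:Z * -1 by apply: ler_wpM2l => //; rewrite -ltzD1.
by lra.
Qed.

Theorem proposition18 (S I : set nat)
    (hS : numerical_semigroup S) (hI : proper_semigroup_ideal S I)
    (n : nat) (a : 'I_n -> int) (a0 : int)
    (hp : linear_endopattern I (linear_poly a a0)) :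
  [/\ linear_pattern (linear_poly a a0) /\ admitted S I (linear_poly a a0),
      forall n' : nat, (1 <= n')%N -> (n' < n)%N ->
        0 <= \sum_(i < n | (i < n')%N) a i,
      Num.max 0 (- a0%:~R / (mu I)%:R) <= (\sum_(i < n) a i)%:~R :> rat
    & 0 < a0 \/
      Num.max 0 (- a0%:~R / (mu I)%:R) < (\sum_(i < n) a i)%:~R :> rat].
Proof.
have [linp valI] := hp; have [idI _] := hI; have [_ sIS _] := idI.
have mu_gt0 := proper_ideal_mu_gt0 _ _ hI.
have partial_ge0 n' : 0 <= \sum_(i < n | (i < n')%N) a i.
  apply: (coef_ge0_of_bounded_below _ _ _ mu_gt0) => k.
  by apply: le_trans (endopattern_step_ge _ _ _ _ _ n' k idI valI).
have sum_ge0 : 0 <= \sum_(i < n) a i.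
  by have := partial_ge0 n; under eq_bigl do rewrite ltn_ord.
have value_mu : (mu I)%:Z <= (\sum_(i < n) a i) * (mu I)%:Z + a0.
  have := endopattern_step_ge _ _ _ _ _ 0 0 idI valI.
  by rewrite mul0n mul0r add0r.
have sum_gt : - a0%:~R / (mu I)%:R < (\sum_(i < n) a i)%:~R :> rat.
  rewrite ltr_pdivrMr ?ltr0n // -mulrNz -[(mu I)%:R]/((mu I)%:Z%:~R) -intrM.
  rewrite ltr_int -subr_gt0 opprK.
  by apply: lt_le_trans value_mu; rewrite ltz_nat.
split=> //.
- by split=> // s /valI [y Iy <-]; exists y => //; apply: sIS.
- by rewrite ge_max ler0z sum_ge0 ltW.
- have [a0_gt0|a0_le0] := ltP 0 a0; [by left|right].
  rewrite gt_max sum_gt andbT ltr0z lt_neqAle sum_ge0 andbT eq_sym.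
  (* A zero sum would give m <= a0 <= 0. *)
  apply/eqP => sum0; move: value_mu; rewrite sum0 mul0r add0r => mu_le_a0.
  by have := le_trans mu_le_a0 a0_le0; rewrite lez_nat leqNgt mu_gt0.
Qed.
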